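(* Every formula of $\mathcal{L}_\mu$ is equivalent over the class of all $\mathsf{wK4}$ models to a formula of $\mathcal{L}_\mu$ with no nested fixed points, i.e. a formula having no subformula of the form $\rho_0x.\phi$ in which some subformula $\rho_1y.\psi$ of $\phi$ (with $\rho_0,\rho_1\in\{\mu,\nu\}$) contains a free occurrence of $x$. In particular the $\mu$-calculus collapses to its alternation-free fragment over $\mathsf{wK4}$ frames.
   Context: A Kripke model is $M=\langle M,\sqsubset,\|\cdot\|\rangle$; $\mathsf{wK4}$ means: for all $a\neq c$, $a\sqsubset b\sqsubset c$ implies $a\sqsubset c$. $\mathcal{L}_\mu$ (negation normal form): $\varphi::=\top\mid x\mid p\mid\neg p\mid\varphi\wedge\varphi\mid\varphi\vee\varphi\mid\Diamond\varphi\mid\Box\varphi\mid\nu x.\varphi\mid\mu x.\varphi$ with standard Kripke semantics ($\Diamond$/$\Box$ over $\sqsubset$-successors; $\mu,\nu$ least/greatest fixed points). Two formulas are equivalent over a class of models if they have the same extension in every model of the class. *)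

(* Defs.v *)
From Stdlib Require Import Arith.

Inductive fp_kind : Type := Mu | Nu.

Inductive form : Type :=
| FTop : form
| FVar : nat -> form
| FProp : nat -> form
| FNProp : nat -> form
| FAnd : form -> form -> form
| FOr : form -> form -> form
| FDia : form -> form
| FBox : form -> form
| FFix : fp_kind -> nat -> form -> form.

Record model : Type := {
  world : Type;
  acc : world -> world -> Prop;
  val : nat -> world -> Prop
}.

Definition wK4 (M : model) : Prop :=
  forall a b c : world M, a <> c -> acc M a b -> acc M b c -> acc M a c.

Definition upd {W : Type} (env : nat -> W -> Prop) (x : nat) (S : W -> Prop)
  : nat -> W -> Prop := fun y => if Nat.eqb y x then S else env y.

(* Extension of a formula under an assignment env of the free variables.
   mu: intersection of all prefixed points; nu: union of all postfixed points
   (Knaster-Tarski; operators are monotone since formulas are in NNF). *)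
Fixpoint sem (M : model) (env : nat -> world M -> Prop) (f : form)
  : world M -> Prop :=
  match f with
  | FTop => fun _ => True
  | FVar x => env x
  | FProp p => val M p
  | FNProp p => fun w => ~ val M p w
  | FAnd a b => fun w => sem M env a w /\ sem M env b w
  | FOr a b => fun w => sem M env a w \/ sem M env b w
  | FDia a => fun w => exists v, acc M w v /\ sem M env a v
  | FBox a => fun w => forall v, acc M w v -> sem M env a v
  | FFix Mu x a => fun w =>
      forall S : world M -> Prop,
        (forall v, sem M (upd env x S) a v -> S v) -> S w
  | FFix Nu x a => fun w =>
      exists S : world M -> Prop,
        (forall v, S v -> sem M (upd env x S) a v) /\ S w
  end.

Definition equiv_wK4 (f g : form) : Prop :=
  forall (M : model) (env : nat -> world M -> Prop),
    wK4 M -> forall w : world M, sem M env f w <-> sem M env g w.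

Fixpoint free_in (x : nat) (f : form) : Prop :=
  match f with
  | FTop | FProp _ | FNProp _ => False
  | FVar y => y = x
  | FAnd a b | FOr a b => free_in x a \/ free_in x b
  | FDia a | FBox a => free_in x a
  | FFix _ y a => y <> x /\ free_in x a
  end.

Inductive subf : form -> form -> Prop :=
| subf_refl : forall f, subf f f
| subf_andl : forall g a b, subf g a -> subf g (FAnd a b)
| subf_andr : forall g a b, subf g b -> subf g (FAnd a b)
| subf_orl : forall g a b, subf g a -> subf g (FOr a b)
| subf_orr : forall g a b, subf g b -> subf g (FOr a b)
| subf_dia : forall g a, subf g a -> subf g (FDia a)
| subf_box : forall g a, subf g a -> subf g (FBox a)
| subf_fix : forall g k x a, subf g a -> subf g (FFix k x a).

Definition no_nested_fp (f : form) : Prop :=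
  forall (r0 : fp_kind) (x : nat) (phi : form),
    subf (FFix r0 x phi) f ->
    forall (r1 : fp_kind) (y : nat) (psi : form),
      subf (FFix r1 y psi) phi -> ~ free_in x (FFix r1 y psi).

(* Main.v *)
(** The truth of all subformulas of [phi] at a world is its kind, and the set of kinds
    found above a world decreases along [acc]. This cuts every model into finitely many
    layers, ordered by a rank that never increases along [acc]. By induction on the sum of
    two ranks, any two pairs (layer, kind) with kinds [k], [k'] such that [k] is not below
    [k'] are separated by a formula all of whose binders bind one fresh variable; such a
    formula has no nested fixed points. [phi] is then a finite disjunction of conjunctions
    of separators.

    In a degenerate layer, the part of a cluster at each of its worlds is determined by the
    layer. A single greatest fixed point describes it, and every world satisfying it
    simulates the cluster, up to lower layers. In the other layers every world sees every
    kind of the layer, and two candidates are available: a greatest fixed point claiming to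
    be in the first layer, and a least one refuting membership in the second. If both
    failed to separate, the two counterexamples would simulate one another, and [k] would be
    below [k']. Negating free variables is impossible, so nothing can be described exactly,
    only from one side; this is why pairs of layers are treated, not single ones. *)

From mathcomp Require Import all_boot boolp zify.
Require Import Defs.

Set Implicit Arguments.
Unset Strict Implicit.
Unset Printing Implicit Defensive.

(** * Fixed points and transfer of truth *)

Lemma updE (W : Type) (e : nat -> W -> Prop) x S z :
  upd e x S z = if z == x then S else e z.
Proof. by []. Qed.

Lemma upd_mono (W : Type) (e e' : nat -> W -> Prop) x (S S' : W -> Prop) :
  (forall z w, e z w -> e' z w) -> (forall w, S w -> S' w) ->
  forall z w, upd e x S z w -> upd e' x S' z w.
Proof. by move=> he hS z w; rewrite !updE; case: eqP => _; auto. Qed.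

Lemma sem_mono M f : forall e e',
  (forall x w, e x w -> e' x w) -> forall w, sem M e f w -> sem M e' f w.
Proof.
elim: f => //=.
- by move=> x e e' H w; apply: H.
- by move=> a IHa b IHb e e' H w [ha hb]; split; [apply: IHa ha | apply: IHb hb].
- by move=> a IHa b IHb e e' H w [h|h]; [left; apply: IHa h | right; apply: IHb h].
- by move=> a IHa e e' H w [v [wv h]]; exists v; split=> //; apply: IHa h.
- by move=> a IHa e e' H w h v wv; apply: IHa (h v wv).
- move=> [] x a IHa e e' H w.
  + move=> h S hS; apply: h => v hv; apply: hS; apply: IHa hv; exact: upd_mono.
  + move=> [S [hS Sw]]; exists S; split=> // v Sv.
    by apply: IHa (hS v Sv); apply: upd_mono.
Qed.

(** Knaster-Tarski: by monotonicity the image of a least (greatest) fixed point is again prefixed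
    (postfixed), which gives the second inclusion. *)
Lemma sem_fix M e k x a w :
  sem M (upd e x (sem M e (FFix k x a))) a w <-> sem M e (FFix k x a) w.
Proof.
case: k; set F := sem M e (FFix _ x a).
- have fold v : sem M (upd e x F) a v -> F v.
    move=> h S hS; apply: (hS).
    by apply: sem_mono h; apply: upd_mono => // u; apply.
  split; first exact: fold.
  apply=> v hv; apply: sem_mono hv; apply: upd_mono => // u; exact: fold.
- have unfold v : F v -> sem M (upd e x F) a v.
    move=> [S [hS Sv]]; apply: sem_mono (hS v Sv); apply: upd_mono => // u Su.
    by exists S.
  split; last exact: unfold.
  move=> h; exists (sem M (upd e x F) a); split=> // v hv.
  apply: sem_mono hv; apply: upd_mono => // u; exact: unfold.
Qed.

Lemma sem_notfree M y f : forall e e',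
  ~ free_in y f -> (forall z, z <> y -> e z = e' z) ->
  sem M e f = sem M e' f.
Proof.
elim: f => //=.
- by move=> x e e' xy H; apply: H.
- by move=> a IHa b IHb e e' ny H; rewrite (IHa e e') ?(IHb e e') //; tauto.
- by move=> a IHa b IHb e e' ny H; rewrite (IHa e e') ?(IHb e e') //; tauto.
- by move=> a IHa e e' ny H; rewrite (IHa e e').
- by move=> a IHa e e' ny H; rewrite (IHa e e').
- move=> k x a IHa e e' ny H.
  have E T : sem M (upd e x T) a = sem M (upd e' x T) a.
    have [eyx|nyx] := eqVneq y x.
      have -> // : upd e x T = upd e' x T.
      apply: funext => z; rewrite !updE; case: eqP => // zx; apply: H.
      by rewrite eyx.
    apply: IHa.
      by move=> fy; apply: ny; split=> // xy; rewrite xy eqxx in nyx.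
    by move=> z zy; rewrite !updE; case: eqP => // _; apply: H.
  by case: k; apply: funext => w; apply: propext; split;
    [move=> h T hT; apply: h => v; rewrite E; apply: hT
    |move=> h T hT; apply: h => v; rewrite -E; apply: hT
    |move=> [T [hT Tw]]; exists T; split=> // v; rewrite -E; apply: hT
    |move=> [T [hT Tw]]; exists T; split=> // v; rewrite E; apply: hT].
Qed.

Fixpoint atoms (f : form) : seq form :=
  match f with
  | FTop => [::]
  | FVar _ | FProp _ | FNProp _ => [:: f]
  | FAnd a b | FOr a b => atoms a ++ atoms b
  | FDia a | FBox a | FFix _ _ a => atoms a
  end.

Lemma atoms_shape g f : List.In g (atoms f) ->
  match g with FVar _ | FProp _ | FNProp _ => True | _ => False end.
Proof.
elim: f => //= [x|p|p|a IHa b IHb|a IHa b IHb].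
- by case=> // <-.
- by case=> // <-.
- by case=> // <-.
- by move=> h; case: (List.in_app_or _ _ _ h).
- by move=> h; case: (List.in_app_or _ _ _ h).
Qed.

(* Inside the body of a fixed point, the bound variable denotes the fixed point. *)
Fixpoint clos M (e : nat -> world M -> Prop) (f : form) : seq (world M -> Prop) :=
  sem M e f ::
  match f with
  | FAnd a b | FOr a b => clos e a ++ clos e b
  | FDia a | FBox a => clos e a
  | FFix k x a => clos (upd e x (sem M e f)) a
  | _ => [::]
  end.

Fixpoint csize (f : form) : nat :=
  (match f with
  | FAnd a b | FOr a b => csize a + csize b
  | FDia a | FBox a | FFix _ _ a => csize a
  | _ => 0
  end).+1.

Lemma size_clos M f : forall e : nat -> world M -> Prop, size (clos e f) = csize f.
Proof.
by elim: f => //= [a IHa b IHb|a IHa b IHb|a IHa|a IHa|k x a IHa] e;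
  rewrite ?size_cat ?IHa ?IHb.
Qed.

(** Entries are compared by position: the two lists live in different models, and equal positions
    come from the same subformula. *)
Definition clos_le M0 (e0 : nat -> world M0 -> Prop) w0
    M (e : nat -> world M -> Prop) w (f : form) :=
  forall i, i < csize f ->
    nth (fun=> False) (clos e0 f) i w0 -> nth (fun=> False) (clos e f) i w.

Lemma clos_le_sem M0 e0 w0 M e w f :
  @clos_le M0 e0 w0 M e w f -> sem M0 e0 f w0 -> sem M e f w.
Proof. by case: f => [|?|?|?|? ?|? ?|?|?|? ? ?] /(_ 0 isT). Qed.

Lemma clos_le_tail M0 e0 w0 M e w f :
  @clos_le M0 e0 w0 M e w f ->
  match f with
  | FAnd a b | FOr a b => clos_le e0 w0 e w a /\ clos_le e0 w0 e w b
  | FDia a | FBox a => clos_le e0 w0 e w a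
  | FFix k x a =>
      clos_le (upd e0 x (sem M0 e0 f)) w0 (upd e x (sem M e f)) w a
  | _ => True
  end.
Proof.
have cat a b : (forall i, i < csize a + csize b ->
    nth (fun=> False) (clos e0 a ++ clos e0 b) i w0 ->
    nth (fun=> False) (clos e a ++ clos e b) i w) ->
    clos_le e0 w0 e w a /\ clos_le e0 w0 e w b.
  move=> H; split=> i ilt.
    have := H i (ltn_addr _ ilt); rewrite !nth_cat !size_clos ilt; exact.
  have := H (csize a + i); rewrite ltn_add2l => /(_ ilt).
  by rewrite !nth_cat !size_clos ltnNge leq_addr /= addKn.
by case: f => //=; intros; try apply: cat; move=> i ilt; apply: (H i.+1).
Qed.

(* Exits of [rho] only have to preserve the true values of the subformulas: when an
   approximant [d0] of a fixed point holds at an exit, so does the fixed point [e0]. *)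
Lemma transfer M0 M (rho : world M0 -> world M -> Prop) f :
  forall e0 e d0 d,
  (forall x v, d0 x v -> e0 x v) -> (forall x v, e x v -> d x v) ->
  (forall g, List.In g (atoms f) -> forall v0 v, rho v0 v ->
     sem M0 d0 g v0 -> sem M d g v) ->
  (forall v0 v, rho v0 v -> forall w0, acc M0 v0 w0 ->
     exists2 w, acc M v w & rho w0 w \/ clos_le e0 w0 e w f) ->
  (forall v0 v, rho v0 v -> forall w, acc M v w ->
     exists2 w0, acc M0 v0 w0 & rho w0 w \/ clos_le e0 w0 e w f) ->
  forall v0 v, rho v0 v -> sem M0 d0 f v0 -> sem M d f v.
Proof.
elim: f => //.
- by move=> x e0 e d0 d _ _ H _ _; apply: H; left.
- by move=> x e0 e d0 d _ _ H _ _; apply: H; left.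
- by move=> x e0 e d0 d _ _ H _ _; apply: H; left.
- move=> a IHa b IHb e0 e d0 d h0 h H zig zag v0 v vv [ha hb]; split.
  + apply: (IHa e0 e d0 d) ha => //.
    * by move=> g ga; apply: H; apply/List.in_or_app; left.
    * move=> ? ? /zig + ? => /[apply] -[w vw [?|/clos_le_tail[]]]; exists w; auto.
    * move=> ? ? /zag + ? => /[apply] -[w vw [?|/clos_le_tail[]]]; exists w; auto.
  + apply: (IHb e0 e d0 d) hb => //.
    * by move=> g ga; apply: H; apply/List.in_or_app; right.
    * move=> ? ? /zig + ? => /[apply] -[w vw [?|/clos_le_tail[]]]; exists w; auto.
    * move=> ? ? /zag + ? => /[apply] -[w vw [?|/clos_le_tail[]]]; exists w; auto.
- move=> a IHa b IHb e0 e d0 d h0 h H zig zag v0 v vv [ha|hb]; [left|right].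
  + apply: (IHa e0 e d0 d) ha => //.
    * by move=> g ga; apply: H; apply/List.in_or_app; left.
    * move=> ? ? /zig + ? => /[apply] -[w vw [?|/clos_le_tail[]]]; exists w; auto.
    * move=> ? ? /zag + ? => /[apply] -[w vw [?|/clos_le_tail[]]]; exists w; auto.
  + apply: (IHb e0 e d0 d) hb => //.
    * by move=> g ga; apply: H; apply/List.in_or_app; right.
    * move=> ? ? /zig + ? => /[apply] -[w vw [?|/clos_le_tail[]]]; exists w; auto.
    * move=> ? ? /zag + ? => /[apply] -[w vw [?|/clos_le_tail[]]]; exists w; auto.
- move=> a IHa e0 e d0 d h0 h H zig zag v0 v vv [w0 [vw0 ha]].
  have [w vw [ww|/clos_le_tail le]] := zig _ _ vv _ vw0; exists w; split=> //.
    apply: (IHa e0 e d0 d) ww ha => //.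
    + move=> ? ? /zig + ? => /[apply] -[u ? [?|/clos_le_tail ?]]; exists u; auto.
    + move=> ? ? /zag + ? => /[apply] -[u ? [?|/clos_le_tail ?]]; exists u; auto.
  by apply: sem_mono h _ (clos_le_sem le (sem_mono h0 ha)).
- move=> a IHa e0 e d0 d h0 h H zig zag v0 v vv ha w vw.
  have [w0 vw0 [ww|/clos_le_tail le]] := zag _ _ vv _ vw; have {}ha := ha _ vw0.
    apply: (IHa e0 e d0 d) ww ha => //.
    + move=> ? ? /zig + ? => /[apply] -[u ? [?|/clos_le_tail ?]]; exists u; auto.
    + move=> ? ? /zag + ? => /[apply] -[u ? [?|/clos_le_tail ?]]; exists u; auto.
  by apply: sem_mono h _ (clos_le_sem le (sem_mono h0 ha)).
- move=> k x a IHa e0 e d0 d h0 h H zig zag v0 v vv.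
  set F0 := sem M0 e0 (FFix k x a); set F := sem M e (FFix k x a).
  have body D0 D : (forall u, D0 u -> F0 u) -> (forall u, F u -> D u) ->
      (forall u0 u, rho u0 u -> D0 u0 -> D u) ->
      forall u0 u, rho u0 u ->
      sem M0 (upd d0 x D0) a u0 -> sem M (upd d x D) a u.
    move=> hD0 hD DD; apply: (IHa (upd e0 x F0) (upd e x F)).
    + exact: upd_mono.
    + exact: upd_mono.
    + move=> g ga u0 u uu.
      have := H g ga _ _ uu; have := DD _ _ uu.
      move/atoms_shape: ga; case: g => //= z _.
      by rewrite !updE; case: eqP.
    + move=> ? ? /zig + ? => /[apply] -[u ? [?|/clos_le_tail ?]]; exists u; auto.
    + move=> ? ? /zag + ? => /[apply] -[u ? [?|/clos_le_tail ?]]; exists u; auto.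
  case: k @F0 @F H zig zag body => F0 F _ _ _ body.
  + move=> hv0 S hS.
    suff [_] : F0 v0 /\ forall u, rho v0 u -> S u by apply.
    (* The tested set also keeps [F0], so that the approximant stays below the fixed point, as exits
       require. *)
    apply: (hv0 (fun u0 => F0 u0 /\ forall u, rho u0 u -> S u)) => u0 hu0; split.
      apply/sem_fix; apply: sem_mono hu0; apply: upd_mono => // z [] //.
    move=> u uu; apply: (hS); apply: (body _ _ _ _ _ _ _ uu hu0).
    * by move=> z [].
    * move=> z; apply; move=> t ht; apply: hS; apply: sem_mono ht.
      exact: upd_mono.
    * by move=> z0 z zz [_]; apply.
  + move=> [S [hS Sv0]].
    (* The image of the postfixed set along [rho], joined with the fixed point itself, which covers
       the exits. *)
    exists (fun u => F u \/ exists2 u0, rho u0 u & S u0); split; last by right; exists v0.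
    move=> u [/sem_fix Fu|[u0 uu Su0]].
      by apply: sem_mono Fu; apply: upd_mono => // z; left.
    apply: (body _ _ _ _ _ _ _ uu (hS _ Su0)).
    * move=> z Sz; exists S; split=> // t St; apply: sem_mono (hS _ St).
      exact: upd_mono.
    * by move=> z; left.
    * by move=> z0 z zz Sz0; right; exists z0.
Qed.

(** [transfer] is reused at each subformula. Under a binder it also supplies the atom condition for
    the bound variable, which denotes the fixed point on both sides. *)
Lemma transfer_clos M0 M (rho : world M0 -> world M -> Prop) f :
  forall e0 e,
  (forall g, List.In g (atoms f) -> forall v0 v, rho v0 v ->
     sem M0 e0 g v0 -> sem M e g v) ->
  (forall v0 v, rho v0 v -> forall w0, acc M0 v0 w0 ->
     exists2 w, acc M v w & rho w0 w \/ clos_le e0 w0 e w f) ->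
  (forall v0 v, rho v0 v -> forall w, acc M v w ->
     exists2 w0, acc M0 v0 w0 & rho w0 w \/ clos_le e0 w0 e w f) ->
  forall v0 v, rho v0 v -> clos_le e0 v0 e v f.
Proof.
have cat a b (e0 : nat -> world M0 -> Prop) (e : nat -> world M -> Prop) v0 v :
    clos_le e0 v0 e v a -> clos_le e0 v0 e v b ->
    forall i, i < csize a + csize b ->
    nth (fun=> False) (clos e0 a ++ clos e0 b) i v0 ->
    nth (fun=> False) (clos e a ++ clos e b) i v.
  move=> ha hb i; rewrite !nth_cat !size_clos; case: (ltnP i (csize a)) => [ia _|ai ilt].
    exact: (ha i ia).
  by apply: (hb (i - csize a)); rewrite ltn_subLR.
have two a b e0 e :
    (forall g, List.In g (atoms a ++ atoms b) -> forall v0 v, rho v0 v ->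
       sem M0 e0 g v0 -> sem M e g v) ->
    (forall g, List.In g (atoms a) -> forall v0 v, rho v0 v ->
       sem M0 e0 g v0 -> sem M e g v) /\
    (forall g, List.In g (atoms b) -> forall v0 v, rho v0 v ->
       sem M0 e0 g v0 -> sem M e g v).
  by move=> H; split=> g gin; apply: H; apply/List.in_or_app; [left|right].
elim: f => [|x|p|p|a IHa b IHb|a IHa b IHb|a IHa|a IHa|k x a IHa] e0 e H zig zag v0 v vv
  [|i] //= ilt; try by apply: (transfer _ _ H zig zag vv).
- have [Ha Hb] := two _ _ _ _ H; apply: cat => //.
  + apply: IHa vv => // ? ? => [/zig|/zag] + ? => /[apply] -[w vw [?|/clos_le_tail[]]];
      exists w; auto.
  + apply: IHb vv => // ? ? => [/zig|/zag] + ? => /[apply] -[w vw [?|/clos_le_tail[]]];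
      exists w; auto.
- have [Ha Hb] := two _ _ _ _ H; apply: cat => //.
  + apply: IHa vv => // ? ? => [/zig|/zag] + ? => /[apply] -[w vw [?|/clos_le_tail[]]];
      exists w; auto.
  + apply: IHb vv => // ? ? => [/zig|/zag] + ? => /[apply] -[w vw [?|/clos_le_tail[]]];
      exists w; auto.
- apply: IHa vv _ ilt => // ? ? => [/zig|/zag] + ? => /[apply] -[w vw [?|/clos_le_tail ?]];
    exists w; auto.
- apply: IHa vv _ ilt => // ? ? => [/zig|/zag] + ? => /[apply] -[w vw [?|/clos_le_tail ?]];
    exists w; auto.
- apply: IHa vv _ ilt => [g ga u0 u uu|? ?|? ?].
  + have := transfer (fun _ _ => id) (fun _ _ => id) H zig zag uu.
    have := H g ga _ _ uu; move/atoms_shape: ga; case: g => //= z _.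
    by rewrite !updE; case: eqP.
  + by move=> /zig + ? => /[apply] -[w vw [?|/clos_le_tail ?]]; exists w; auto.
  + by move=> /zag + ? => /[apply] -[w vw [?|/clos_le_tail ?]]; exists w; auto.
Qed.

(** * Layers of a weakly transitive relation *)

Section Layers.
Variables (W : Type) (R : W -> W -> Prop) (K : finType) (kd : W -> K).
Hypothesis wtrans : forall a b c, a <> c -> R a b -> R b c -> R a c.

Definition refl u v := u = v \/ R u v.
Definition cluster u v := refl u v /\ refl v u.

(** Weak transitivity amounts to transitivity of the reflexive closure, so [cluster] is an
    equivalence. *)
Lemma refl_trans a b c : refl a b -> refl b c -> refl a c.
Proof.
case=> [->//|ab] [<-|bc]; first by right.
by have [->|ac] := pselect (a = c); [left | right; apply: wtrans bc].
Qed.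

Lemma cluster_sym u v : cluster u v -> cluster v u.
Proof. by case. Qed.

Lemma cluster_trans a b c : cluster a b -> cluster b c -> cluster a c.
Proof. by move=> [ab ba] [bc cb]; split; [apply: refl_trans bc|apply: refl_trans ba]. Qed.

Definition up_kinds w := [set k | `[< exists2 v, refl w v & kd v = k >]].
(* Some world of the cluster of [w] sees no world of its own kind: by weak transitivity,
   no world beyond the cluster has the same [up_kinds]. *)
Definition degenerate w := exists2 z, cluster w z & ~ exists2 v, R z v & kd v = kd z.
Definition in_kinds w := [set k | `[< exists2 v, cluster w v & kd v = k >]].
Definition self_seen w := [set k | `[< exists v v',
  [/\ cluster w v, cluster w v', R v v', kd v = k & kd v' = k] >]].
Definition out_kinds w := [set k | `[< exists v, [/\ R w v, ~ cluster w v & kd v = k] >]].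

(** Cluster data is stored for degenerate worlds only; for the others, marked [None], the first
    component already determines the kinds seen. *)
Definition layer_id : finType :=
  ({set K} * option ({set K} * {set K} * {set K}))%type.

Definition layer w : layer_id :=
  (up_kinds w,
   if `[< degenerate w >] then Some (in_kinds w, self_seen w, out_kinds w) else None).

(** Doubling leaves one unit for the step from a [None] layer to a degenerate one with the same
    [up_kinds]; by [degenerate_final] the reverse step does not occur. *)
Definition rank (l : layer_id) := (#|l.1|.*2 + (l.2 == None))%N.

(** Distinct worlds of a cluster see each other, so a member of kind [k] sees every other kind of
    [A]; whether it sees [k] is decided by [S]. *)
Definition seen_in (A S : {set K}) k := if k \in S then A else A :\ k.

Lemma up_kinds_sub u v : refl u v -> up_kinds v \subset up_kinds u.
Proof.
move=> uv; apply/subsetP => k; rewrite !inE => /asboolP[w vw <-].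
by apply/asboolP; exists w => //; apply: refl_trans vw.
Qed.

(** Let [z] be the world seeing no world of its own kind. That kind recurs above [v], hence above
    [z], and this can only be at [z] itself; so [v] leads back to [z] and then to [w]. *)
Lemma degenerate_final w v :
  degenerate w -> R w v -> up_kinds v = up_kinds w -> cluster w v.
Proof.
move=> [z [wz zw] zlast] wv ups; split; first by right.
have : kd z \in up_kinds v by rewrite ups inE; apply/asboolP; exists z.
rewrite inE => /asboolP[z2 vz2 kz2].
have zz2 : refl z z2 by apply: refl_trans zw _; apply: refl_trans vz2; right.
case: zz2 => [zz2|zz2]; last by case: zlast; exists z2.
by rewrite -zz2 in vz2; apply: refl_trans zw.
Qed.

Lemma cluster_layer w v : cluster w v -> layer v = layer w.
Proof.
move=> wv; have vw := cluster_sym wv.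
have cE x : cluster v x = cluster w x.
  by apply: propext; split; apply: cluster_trans.
have upE : up_kinds v = up_kinds w.
  by apply/eqP; rewrite eqEsubset !up_kinds_sub //; [apply vw.1|apply wv.1].
have dE : degenerate v = degenerate w.
  by apply: propext; split=> -[z]; rewrite ?cE => ? ?; exists z; rewrite ?cE.
rewrite /layer upE dE; congr (_, _); case: ifP => // _; congr (Some (_, _, _)).
- by apply/setP => k; rewrite !inE; apply/asboolP/asboolP => -[x];
    rewrite ?cE => ? ?; exists x; rewrite ?cE.
- by apply/setP => k; rewrite !inE; apply/asboolP/asboolP => -[x [x']];
    rewrite ?cE => ?; exists x, x'; rewrite ?cE.
- apply/setP => k; rewrite !inE; apply/asboolP/asboolP => -[x [ax nx kx]]; exists x.
  + split=> //; last by rewrite -cE.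
    have [|//] : refl w x by apply: refl_trans wv.1 _; right.
    by move=> wx; case: nx; rewrite -wx.
  + split=> //; last by rewrite cE.
    have [|//] : refl v x by apply: refl_trans vw.1 _; right.
    by move=> wx; case: nx; rewrite -wx.
Qed.

Lemma rank_lt (l1 l2 : layer_id) : l1.1 \proper l2.1 -> rank l1 < rank l2.
Proof. by move/proper_card; rewrite /rank; case: eqP; case: eqP; lia. Qed.

Lemma layer_succ w v : R w v -> layer v = layer w \/ rank (layer v) < rank (layer w).
Proof.
move=> wv; have sub : up_kinds v \subset up_kinds w by apply: up_kinds_sub; right.
have [E|N] := eqVneq (up_kinds v) (up_kinds w); last first.
  by right; apply: rank_lt; rewrite properEneq N.
have [dw|ndw] := pselect (degenerate w).
  by left; apply: cluster_layer; apply: degenerate_final.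
rewrite /layer /rank (asboolF ndw) E /=; case: asboolP => _ /=; last by left.
by right; lia.
Qed.

(** Only the kind of [w] itself is in question, and a [w] not seeing it would be a witness of
    degeneracy. *)
Lemma layer_regular w Rs : layer w = (Rs, None) ->
  (forall k, k \in Rs -> exists2 v, R w v & kd v = k) /\
  (forall v, R w v -> kd v \in Rs).
Proof.
move=> [<-]; case: asboolP => // ndw _; split=> [k|v wv].
- rewrite inE => /asboolP[v [wv|wv] kv]; last by exists v.
  rewrite -wv in kv; rewrite -kv; apply: contrapT => H; apply: ndw.
  by exists w => //; split; left.
- by rewrite inE; apply/asboolP; exists v => //; right.
Qed.

Lemma layer_degenerate w Rs A S E : layer w = (Rs, Some (A, S, E)) ->
  [/\ kd w \in A,
     forall k, k \in seen_in A S (kd w) ->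
       exists2 v, R w v & layer v = layer w /\ kd v = k,
     forall k, k \in E -> exists2 v, R w v & rank (layer v) < rank (layer w) /\ kd v = k
   & forall v, R w v -> (layer v = layer w /\ kd v \in seen_in A S (kd w)) \/
       (rank (layer v) < rank (layer w) /\ kd v \in E)].
Proof.
rewrite {1}/layer; case: asboolP => // dw [_ <- <- <-].
have cw : cluster w w by split; left.
have out v : R w v -> ~ cluster w v -> rank (layer v) < rank (layer w).
  move=> wv nc; apply: rank_lt; rewrite properEneq up_kinds_sub; last by right.
  by rewrite andbT; apply/eqP => /(degenerate_final dw wv).
have inA v : cluster w v -> kd v \in in_kinds w.
  by move=> wv; rewrite inE; apply/asboolP; exists v.
split.
- exact: inA.
- move=> k; rewrite /seen_in; case: ifP.
  + rewrite !inE => /asboolP[v [v' [wv wv' vv' kv kv']]].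
    move=> /asboolP[x wx kx]; case: (wx) => -[ex|ax] _; last first.
      by exists x => //; split=> //; apply: cluster_layer.
    (* Here [w] has kind [k] itself: it sees [v'], or sees [v], or equals both, and then the edge
       from [v] to [v'] is a loop at [w]. *)
    have {}kw : kd w = k by rewrite ex.
    case: (wv') => -[ev'|av'] _; last first.
      by exists v' => //; split; [apply: cluster_layer | rewrite kv' kw].
    case: (wv) => -[ev|av] _.
      exists v'; first by rewrite {1}ev.
      by split; [apply: cluster_layer | rewrite kv' kw].
    by exists v => //; split; [apply: cluster_layer | rewrite kv kw].
  + rewrite !inE => _ /andP[kw /asboolP[x wx kx]]; case: (wx) => -[ex|ax] _.
      by rewrite -kx -ex eqxx in kw.
    by exists x => //; split=> //; apply: cluster_layer.
- move=> k; rewrite inE => /asboolP[v [wv nc kv]].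
  by exists v => //; split=> //; apply: out.
- move=> v wv; have [c|nc] := pselect (cluster w v); last first.
    by right; split; [apply: out | rewrite inE; apply/asboolP; exists v].
  left; split; first exact: cluster_layer.
  rewrite /seen_in; case: ifP => [_|ns]; first exact: inA.
  rewrite in_setD1 inA // andbT; apply/eqP => kv; move: ns.
  rewrite inE => /asboolP; apply; exists w, v; split=> //.
Qed.

End Layers.

(** * Stabilization of roles in a degenerate cluster *)

Section Stabilization.
Variables (W : Type) (R : W -> W -> Prop) (K : finType).
Hypothesis wtrans : forall a b c, a <> c -> R a b -> R b c -> R a c.
Variables (A S : {set K}) (P : K -> W -> Prop) (Out Y : W -> Prop).

Local Notation O := (seen_in A S).

(* [roles j k w]: [w] can play the in-cluster kind [k] for [j] rounds. A world may be able
   to play several kinds and the single variable [Y] does not record which one; by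
   [roles_stable], enough rounds make up for this. *)
Fixpoint roles j k w : Prop :=
  match j with
  | 0 => P k w /\ Y w
  | j.+1 => (P k w /\ Y w) /\
      ((forall k1, k1 \in O k -> exists2 v, R w v & roles j k1 v) /\
       (forall v, R w v -> Out v \/ exists2 k1, k1 \in O k & roles j k1 v))
  end.

Lemma seen_in_sub k : O k \subset A.
Proof. by rewrite /seen_in; case: ifP => // _; apply: subsetDl. Qed.

Lemma rolesS j : forall k w, roles j.+1 k w -> roles j k w.
Proof.
elim: j => [|j IHj] k w; first by case.
move=> [PY [D X]]; split=> //; split.
  by move=> k1 /D[v wv /IHj ?]; exists v.
by move=> v /X[|[k1 ? /IHj ?]]; [left | right; exists k1].
Qed.

Lemma roles_anti i j k w : i <= j -> roles j k w -> roles i k w.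
Proof.
move=> ij; rewrite -(subnK ij); elim: (j - i) => // m IHm; rewrite addSn.
by move/rolesS.
Qed.

Lemma roles_stable n : n = (2 * #|K|).+1 ->
  (forall w, Y w -> exists2 k, k \in A & roles n.+1 k w) ->
  forall k w, k \in A -> roles n k w -> roles n.+1 k w.
Proof.
move=> nE HY.
have YR j k w : roles j k w -> Y w by case: j => [|j] [] // [].
(* A failure at level [j] produces a failure at level [j - 1], either because a kind is
   not seen (label [true]) or because a successor has no allowed role (label [false]);
   the labels along this descent are pairwise distinct. *)
pose mark j u (l : bool * K) := let: (d, k) := l in
  exists i z, [/\ i <= j, refl R u z, roles n.+1 k z &
    if d then ~ exists2 v, R z v & roles i k v
    else ~ Out z /\ forall k1, k1 \in O k -> ~ roles i k1 z].
have desc j : j <= n -> forall u k, k \in A -> roles j k u -> ~ roles j.+1 k u ->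
    exists2 s : {set bool * K}, #|s| = j & forall l, l \in s -> mark j u l.
  elim: j => [_ u k _ _ _|j IHj jn u k kA rj nrj].
    by exists set0; [rewrite cards0 | move=> l; rewrite inE].
  have ref_step v z : R u v -> refl R v z -> refl R u z.
    by move=> uv vz; apply: (refl_trans wtrans) vz; right.
  have lift v s : R u v -> (forall l, l \in s -> mark j v l) ->
      forall l, l \in s -> mark j.+1 u l.
    move=> uv H [d k1] /H[i [z [ij vz rz hz]]]; exists i, z; split=> //.
      exact: leqW.
    exact: ref_step vz.
  have [PY [D X]] := rj.
  have Yu := YR _ _ _ rj.
  have [D'|] := pselect (forall k1, k1 \in O k ->
      exists2 v, R u v & roles j.+1 k1 v); last first.
    move=> /existsNP[k1 /not_implyP[k1O nsee]].
    have k1A := subsetP (seen_in_sub k) _ k1O.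
    have [v uv rv] := D _ k1O.
    (* [u] lies in [Y] and has a full role; a role other than [k1] would oblige it to see [k1]
       played for [n] rounds, against [nsee]. *)
    have ru : roles n.+1 k1 u.
      have [k2 k2A r2] := HY _ Yu; suff <- : k2 = k1 by [].
      apply: contrapT => k21; apply: nsee.
      have [_ [D2 _]] := r2; have [|x ux rx] := D2 k1.
        by rewrite /seen_in; case: ifP => // _; rewrite in_setD1 k1A andbT eq_sym; apply/eqP.
      by exists x => //; apply: roles_anti rx.
    have [|s sj sH] := IHj (ltnW jn) v k1 k1A rv.
      by move=> rv'; apply: nsee; exists v.
    (* If the label already occurred at [z]: for [z = u], the successor [v] refutes that failure;
       otherwise [u] sees [z], whose full role [k1] refutes [nsee]. *)
    exists ((true, k1) |: s).
      rewrite cardsU1 sj; case: (boolP (_ \in s)) => // /sH[i [z [ij vz rz hz]]].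
      case: (ref_step _ _ uv vz) => [uz|uz].
        by case: hz; rewrite -uz; exists v => //; apply: roles_anti rv.
      by case: nsee; exists z => //; apply: roles_anti rz; lia.
    move=> l; rewrite in_setU1 => /orP[/eqP ->|]; last exact: lift uv sH l.
    by exists j.+1, u; split=> //; left.
  have [X'|] := pselect (forall v, R u v ->
      Out v \/ exists2 k1, k1 \in O k & roles j.+1 k1 v); first by case: nrj.
  move=> /existsNP[v /not_implyP[uv /not_orP[nout nrole]]].
  have {}nrole k1 : k1 \in O k -> ~ roles j.+1 k1 v.
    by move=> k1O r1; apply: nrole; exists k1.
  have [//|[k1 k1O rv]] := X _ uv.
  have k1A := subsetP (seen_in_sub k) _ k1O.
  (* [v] has a full role in [A] but none in [O k], so it is [k]. *)
  have rkv : roles n.+1 k v.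
    have [k2 k2A r2] := HY _ (YR _ _ _ rv); suff <- : k2 = k by [].
    apply: contrapT => k2k; apply: (nrole k2).
      by rewrite /seen_in; case: ifP => // _; rewrite in_setD1 k2A andbT; apply/eqP.
    by apply: roles_anti r2; lia.
  have [|s sj sH] := IHj (ltnW jn) v k1 k1A rv; first exact: nrole.
  (* An earlier occurrence at [v] contradicts [rv]; one beyond [v] contradicts the full role [k] of
     [v], which constrains its successors. *)
  exists ((false, k) |: s).
    rewrite cardsU1 sj; case: (boolP (_ \in s)) => // /sH[i [z [ij vz rz [nz hz]]]].
    case: vz => [vz|vz]; first by case: (hz _ k1O); rewrite -vz; apply: roles_anti rv.
    have [_ [_ X2]] := rkv; have [//|[k2 k2O r2]] := X2 _ vz.
    by case: (hz _ k2O); apply: roles_anti r2; lia.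
  move=> l; rewrite in_setU1 => /orP[/eqP ->|]; last exact: lift uv sH l.
  by exists j.+1, v; split=> //; right.
move=> k w kA rw; apply: contrapT => nrw.
(* [n] exceeds by one the number of labels in [bool * K]. *)
have [s sn _] := desc n (leqnn _) w k kA rw nrw.
by have := max_card (mem s); rewrite sn card_prod card_bool nE ltnn.
Qed.

End Stabilization.

(** * Formulas with a polarity *)

(* [sgn true] is the point of view of the verifier, [sgn false] that of the refuter. *)
Definition sgn (b : bool) (A : Prop) : Prop := if b then A else ~ A.

Lemma sgn_negb b A : sgn (~~ b) A = ~ sgn b A.
Proof. by case: b; rewrite //= notK. Qed.

(** Connectives as seen by player [b]: refuting a disjunction is refuting both sides, so one
    argument serves both players. *)
Definition cj b f g := if b then FAnd f g else FOr f g.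
Definition dj b := cj (~~ b).
Definition dia b f := if b then FDia f else FBox f.
Definition box b := dia (~~ b).
Definition top b := if b then FTop else FAnd (FProp 0) (FNProp 0).
Definition bigcj b T (s : seq T) (F : T -> form) := foldr (fun t => cj b (F t)) (top b) s.
Definition bigdj b T (s : seq T) (F : T -> form) := bigcj (~~ b) s F.

Section Polarity.
Variables (M : model) (e : nat -> world M -> Prop) (b : bool).

Local Notation "w |= f" := (sgn b (sem M e f w)) (at level 70).

Lemma sgn_cj f g w : (w |= cj b f g) = ((w |= f) /\ (w |= g)).
Proof. by case: b => //=; rewrite not_orE. Qed.

Lemma sgn_dj f g w : (w |= dj b f g) = ((w |= f) \/ (w |= g)).
Proof. by case: b => //=; rewrite not_andE. Qed.

Lemma sgn_dia f w : (w |= dia b f) = exists2 v, acc M w v & v |= f.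
Proof.
case: b => /=; apply: propext; split.
- by case=> v []; exists v.
- by case=> v; exists v.
- by move=> /existsNP[v /not_implyP[]]; exists v.
- by case=> v wv nv h; apply: nv; apply: h.
Qed.

Lemma sgn_box f w : (w |= box b f) = forall v, acc M w v -> v |= f.
Proof.
case: b => //=; apply: propext; split.
- by move=> h v wv hv; apply: h; exists v.
- by move=> h [v [wv]]; apply: h.
Qed.

Lemma sgn_bigcj (T : eqType) (s : seq T) F w :
  (w |= bigcj b s F) = forall t, t \in s -> w |= F t.
Proof.
elim: s => [|t s IH].
  by apply: propext; split=> // _; case: b => //= -[].
rewrite [bigcj _ _ _]/= sgn_cj IH; apply: propext; split.
  by move=> [h1 h2] u; rewrite inE => /orP[/eqP->|/h2].
by move=> h; split=> [|u us]; apply: h; rewrite inE ?eqxx ?us ?orbT.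
Qed.

Lemma sgn_bigdj (T : eqType) (s : seq T) F w :
  (w |= bigdj b s F) = exists2 t, t \in s & w |= F t.
Proof.
elim: s => [|t s IH].
  apply: propext; split=> [|[]//]; rewrite /bigdj /bigcj /=.
  by case: b => /= [[]|/(_ I)].
rewrite [bigdj _ _ _]/= -/(dj b _ _) sgn_dj IH; apply: propext; split.
  by case=> [h|[u us h]]; [exists t|exists u]; rewrite // inE ?eqxx ?us ?orbT.
by case=> u; rewrite inE => /orP[/eqP->|us] h; [left | right; exists u].
Qed.

End Polarity.

Definition fixp b y f := FFix (if b then Nu else Mu) y f.

(** For the refuter the complement of [S] is a prefixed point, so a least fixed point is refuted by
    the same coinduction that verifies a greatest one. *)
Lemma fixp_coind M e b y f (S : world M -> Prop) :
  (forall v, S v -> sgn b (sem M (upd e y (fun u => sgn b (S u))) f v)) ->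
  forall w, S w -> sgn b (sem M e (fixp b y f) w).
Proof.
case: b => H w Sw /=; first by exists S.
move=> h; have := h (fun u => ~ S u); case=> // v hv Sv; exact: H hv.
Qed.

(** * Formulas all of whose binders bind one variable *)

Fixpoint binders y f : Prop :=
  match f with
  | FTop | FVar _ | FProp _ | FNProp _ => True
  | FAnd a b | FOr a b => binders y a /\ binders y b
  | FDia a | FBox a => binders y a
  | FFix _ x a => x = y /\ binders y a
  end.

Lemma binders_sub y f g : subf g f -> binders y f -> binders y g.
Proof. by elim=> //= ? ? ? ? ?; tauto. Qed.

(* A binder of [y] captures every occurrence of [y] below it. *)
Lemma binders_no_nested y f : binders y f -> no_nested_fp f.
Proof.
move=> bf r0 x h /binders_sub/(_ bf) /= [-> bh] r1 z g /binders_sub/(_ bh) /= [-> _].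
by case.
Qed.

(** Such formulas keep their value when [y] is reassigned, so they can be placed under a new binder
    of [y]; this lets the construction iterate. *)
Definition clean y f := binders y f /\ ~ free_in y f.

Section Binders.
Variables (y : nat) (b : bool).

Lemma binders_cj f g : binders y (cj b f g) <-> binders y f /\ binders y g.
Proof. by case: b. Qed.

Lemma binders_dia f : binders y (dia b f) <-> binders y f.
Proof. by case: b. Qed.

Lemma binders_bigcj (T : eqType) (s : seq T) F :
  (forall t, t \in s -> binders y (F t)) -> binders y (bigcj b s F).
Proof.
elim: s => [|t s IH] h; first by case: b.
rewrite [bigcj _ _ _]/=; apply/binders_cj; split; first by apply: h; rewrite inE eqxx.
by apply: IH => u us; apply: h; rewrite inE us orbT.
Qed.

Lemma clean_cj f g : clean y f -> clean y g -> clean y (cj b f g).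
Proof. by rewrite /clean; case: b => /=; tauto. Qed.

Lemma clean_dia f : clean y f -> clean y (dia b f).
Proof. by rewrite /clean; case: b => /=. Qed.

Lemma clean_bigcj (T : eqType) (s : seq T) F :
  (forall t, t \in s -> clean y (F t)) -> clean y (bigcj b s F).
Proof.
elim: s => [|t s IH] h; first by rewrite /clean; case: b => /=; tauto.
rewrite [bigcj _ _ _]/=; apply: clean_cj; first by apply: h; rewrite inE eqxx.
by apply: IH => u us; apply: h; rewrite inE us orbT.
Qed.

Lemma clean_fixp f : binders y f -> clean y (fixp b y f).
Proof. by move=> bf; split=> //= -[]. Qed.

End Binders.

Lemma clean_bigdj y b (T : eqType) (s : seq T) F :
  (forall t, t \in s -> clean y (F t)) -> clean y (bigdj b s F).
Proof. exact: clean_bigcj. Qed.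

Lemma clean_upd y M e S f : clean y f -> sem M (upd e y S) f = sem M e f.
Proof.
move=> [_ nf]; apply: (@sem_notfree _ y) => // z zy.
by rewrite updE; case: eqP.
Qed.

(** * Separating formulas *)

Fixpoint var_bound (f : form) : nat :=
  match f with
  | FVar x => x.+1
  | FAnd a b | FOr a b => maxn (var_bound a) (var_bound b)
  | FDia a | FBox a | FFix _ _ a => var_bound a
  | _ => 0
  end.

Lemma atoms_clean f g m : List.In g (atoms f) -> var_bound f <= m -> clean m g.
Proof.
elim: f => //= [x|p|p|a IHa b IHb|a IHa b IHb].
- by case=> // <- xm; split=> //= E; rewrite E ltnn in xm.
- by case=> // <-; split=> // -[].
- by case=> // <-; split=> // -[].
- rewrite geq_max => h /andP[am bm].
  by case: (List.in_app_or _ _ _ h) => [/IHa|/IHb]; apply.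
- rewrite geq_max => h /andP[am bm].
  by case: (List.in_app_or _ _ _ h) => [/IHa|/IHb]; apply.
Qed.

Lemma In_nth (T : Type) (x0 x : T) s : List.In x s -> exists2 i, i < size s & nth x0 s i = x.
Proof.
elim: s => //= z s IH [->|/IH[i ilt <-]]; first by exists 0.
by exists i.+1.
Qed.

Lemma nth_In (T : Type) (x0 : T) s i : i < size s -> List.In (nth x0 s i) s.
Proof. by elim: s i => //= z s IH [|i] ilt; [left | right; apply: IH]. Qed.

Section Separation.
Variable phi : form.

Definition feature_count := size (atoms phi) + csize phi.
Definition kinds : finType := {set 'I_feature_count}.
Definition fresh := var_bound phi.

(** The atoms come first, being the entries that [atoms_at_least] states directly; next comes the
    truth of [phi] itself. *)
Definition features M (e : nat -> world M -> Prop) :=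
  map (sem M e) (atoms phi) ++ clos e phi.

Definition kind M (e : nat -> world M -> Prop) (w : world M) : kinds :=
  [set i : 'I_feature_count | `[< nth (fun=> False) (features e) i w >]].

Definition kle b (k k' : kinds) := if b then k \subset k' else k' \subset k.

(** The verifier asserts the atoms in [k]; the refuter denies those outside [k]. *)
Definition atoms_at_least b (k : kinds) :=
  bigcj b [seq i : 'I_feature_count <- enum 'I_feature_count
            | (i < size (atoms phi)) && ((i \in k) == b)]
    (fun i => nth FTop (atoms phi) i).

Lemma in_kind_atom M (e : nat -> world M -> Prop) w (i : 'I_feature_count) :
  i < size (atoms phi) -> (i \in kind e w) = `[< sem M e (nth FTop (atoms phi) i) w >].
Proof.
by move=> ilt; rewrite inE nth_cat size_map ilt (nth_map FTop).
Qed.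

Lemma atoms_at_leastP b M0 (e0 : nat -> world M0 -> Prop) w0
    M (e : nat -> world M -> Prop) w :
  sgn b (sem M e (atoms_at_least b (kind e0 w0)) w) <->
  forall g, List.In g (atoms phi) ->
    if b then sem M0 e0 g w0 -> sem M e g w else sem M e g w -> sem M0 e0 g w0.
Proof.
rewrite sgn_bigcj; split=> H.
  move=> g /(In_nth FTop)[i ilt ig].
  have ilt' : i < feature_count by rewrite ltn_addr.
  have := H (Ordinal ilt'); rewrite mem_filter /= ilt mem_enum andbT ig.
  rewrite in_kind_atom //= ig; case: (b) => /= h.
  - by move=> h0; apply: h; apply/eqP/asboolP.
  - move=> h1; apply: contrapT => h0; apply: h h1.
    by apply/eqP; apply/asboolP.
move=> i; rewrite mem_filter => /andP[/andP[ilt /eqP]].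
rewrite in_kind_atom // => E _; have := H _ (nth_In FTop ilt); move: E; case: (b) => /=.
  by move/asboolP => h0; apply.
by move=> E h1 /h1 h; move/asboolP: h; rewrite E.
Qed.

Lemma atoms_at_least_negb b M0 (e0 : nat -> world M0 -> Prop) w0
    M (e : nat -> world M -> Prop) w :
  sgn (~~ b) (sem M0 e0 (atoms_at_least (~~ b) (kind e w)) w0) ->
  sgn b (sem M e (atoms_at_least b (kind e0 w0)) w).
Proof. by move/atoms_at_leastP => H; apply/atoms_at_leastP => g /H {H}; case: (b). Qed.

Lemma atoms_at_least_kind b M (e : nat -> world M -> Prop) w :
  sgn b (sem M e (atoms_at_least b (kind e w)) w).
Proof. by apply/atoms_at_leastP => g _; case: b. Qed.

Lemma kind_sub M0 (e0 : nat -> world M0 -> Prop) w0 M (e : nat -> world M -> Prop) w :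
  kind e0 w0 \subset kind e w <->
  (forall g, List.In g (atoms phi) -> sem M0 e0 g w0 -> sem M e g w) /\
  clos_le e0 w0 e w phi.
Proof.
split.
- move/subsetP=> H; split.
  + move=> g /(In_nth FTop)[i ilt <-] h.
    have ilt' : i < feature_count by rewrite ltn_addr.
    have := H (Ordinal ilt'); rewrite !in_kind_atom //=.
    by move=> /(_ (asboolT h))/asboolP.
  + move=> i ilt h.
    have ilt' : size (atoms phi) + i < feature_count by rewrite ltn_add2l.
    have := H (Ordinal ilt'); rewrite !inE !nth_cat !size_map /=.
    rewrite ltnNge leq_addr /= addKn.
    by move=> /(_ (asboolT h))/asboolP.
- move=> [Ha Hc]; apply/subsetP => i; have [ia|ai] := ltnP i (size (atoms phi)).
    by rewrite !in_kind_atom // => /asboolP h; apply/asboolP; apply: Ha h; apply: nth_In.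
  rewrite !inE !nth_cat !size_map ltnNge ai /= => /asboolP h.
  by apply/asboolP; apply: Hc h; rewrite ltn_subLR.
Qed.

(** [transfer_clos] is applied to [rho] for the verifier and to its converse, with zig and zag
    exchanged, for the refuter. *)
Lemma simulation_kle b M0 (e0 : nat -> world M0 -> Prop) M (e : nat -> world M -> Prop)
    (rho : world M0 -> world M -> Prop) :
  (forall w0 w, rho w0 w -> sgn b (sem M e (atoms_at_least b (kind e0 w0)) w)) ->
  (forall w0 w, rho w0 w -> forall v0, acc M0 w0 v0 ->
     exists2 v, acc M w v & rho v0 v \/ kle b (kind e0 v0) (kind e v)) ->
  (forall w0 w, rho w0 w -> forall v, acc M w v ->
     exists2 v0, acc M0 w0 v0 & rho v0 v \/ kle b (kind e0 v0) (kind e v)) ->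
  forall w0 w, rho w0 w -> kle b (kind e0 w0) (kind e w).
Proof.
case: b => /= H zig zag w0 w ww; apply/kind_sub; split.
- exact: ((atoms_at_leastP true _ _ _ _).1 (H _ _ ww)).
- apply: (transfer_clos (rho := rho)) => //.
  + by move=> g ga v0 v vv; apply: ((atoms_at_leastP true _ _ _ _).1 (H _ _ vv)).
  + move=> ? ? /zig + ? => /[apply] -[v wv [?|/kind_sub[]]]; exists v; auto.
  + move=> ? ? /zag + ? => /[apply] -[v wv [?|/kind_sub[]]]; exists v; auto.
- exact: ((atoms_at_leastP false _ _ _ _).1 (H _ _ ww)).
- apply: (transfer_clos (rho := fun v v0 => rho v0 v)) => //.
  + by move=> g ga v0 v vv; apply: ((atoms_at_leastP false _ _ _ _).1 (H _ _ vv)).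
  + move=> ? ? /zag + ? => /[apply] -[v wv [?|/kind_sub[]]]; exists v; auto.
  + move=> ? ? /zig + ? => /[apply] -[v wv [?|/kind_sub[]]]; exists v; auto.
Qed.

Definition wtype : finType := (layer_id kinds * kinds)%type.

Definition wlayer M (e : nat -> world M -> Prop) w : layer_id kinds :=
  layer (acc M) (kind e) w.

Definition separates b (t t' : wtype) f :=
  [/\ clean fresh f,
     forall M e w, wK4 M -> (wlayer e w, kind e w) = t -> sgn b (sem M e f w)
   & forall M e w, wK4 M -> (wlayer e w, kind e w) = t' -> ~ sgn b (sem M e f w)].

Definition separable b t t' := exists f, separates b t t' f.

Lemma separable_negb b t t' : separable b t t' -> separable (~~ b) t' t.
Proof.
move=> [f [cf h h']]; exists f; split=> // M e w wM E; rewrite sgn_negb; first exact: h'.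
by rewrite notK; apply: h.
Qed.

(** A classical choice; the default [FTop] keeps it clean where no separating formula exists. *)
Definition separator b t t' : form :=
  match pselect (separable b t t') with
  | left h => projT1 (cid h)
  | right _ => FTop
  end.

Lemma separatorP b t t' : separable b t t' -> separates b t t' (separator b t t').
Proof. by move=> h; rewrite /separator; case: pselect => // h'; case: cid. Qed.

Lemma clean_separator b t t' : clean fresh (separator b t t').
Proof.
rewrite /separator; case: pselect => [h|_]; last by split=> // -[].
by case: cid => f [].
Qed.

Lemma kle_negb b k k' : kle (~~ b) k k' = kle b k' k.
Proof. by case: b. Qed.

Section Step.
Variables (b : bool) (l l' : layer_id kinds).
Hypothesis IH : forall l1 k1 l2 k2, rank l1 <= rank l -> rank l2 <= rank l' ->
  rank l1 + rank l2 < rank l + rank l' -> ~~ kle b k1 k2 ->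
  separable b (l1, k1) (l2, k2).

(* [known k1] is claimed at points below layer [l], [candidate k1] at points of [l]. *)
Definition known (k1 : kinds) :=
  bigdj b [seq l1 : layer_id kinds <- enum (layer_id kinds) | rank l1 < rank l] (fun l1 =>
    bigcj b [seq t : wtype <- enum wtype | (rank t.1 <= rank l') && ~~ kle b k1 t.2]
      (separator b (l1, k1))).

Definition candidate (k1 : kinds) :=
  cj b (atoms_at_least b k1)
    (bigcj b [seq t : wtype <- enum wtype | (rank t.1 < rank l') && ~~ kle b k1 t.2]
      (separator b (l, k1))).

Lemma clean_atoms_at_least c k1 : clean fresh (atoms_at_least c k1).
Proof.
apply: clean_bigcj => i; rewrite mem_filter => /andP[/andP[ilt _] _].
by apply: (@atoms_clean phi); first exact: nth_In.
Qed.

Lemma clean_known k1 : clean fresh (known k1).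
Proof.
by apply: clean_bigdj => l1 _; apply: clean_bigcj => t _; apply: clean_separator.
Qed.

Lemma clean_candidate k1 : clean fresh (candidate k1).
Proof.
apply: clean_cj; first exact: clean_atoms_at_least.
by apply: clean_bigcj => t _; apply: clean_separator.
Qed.

Section Model.
Variables (M : model) (e : nat -> world M -> Prop).
Hypothesis wM : wK4 M.

Lemma known_kind w : rank (wlayer e w) < rank l -> sgn b (sem M e (known (kind e w)) w).
Proof.
move=> wl; rewrite sgn_bigdj; exists (wlayer e w).
  by rewrite mem_filter wl mem_enum.
rewrite sgn_bigcj => -[l2 k2]; rewrite mem_filter => /andP[/andP[/= rl nk] _].
have [|_ h _] := @separatorP b (wlayer e w, kind e w) (l2, k2); last exact: h.
by apply: IH => //; [exact: ltnW | lia].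
Qed.

(** Whichever layer [l1] the disjunction picks, a kind not above [k1] would falsify the separator
    against the type of [w]. *)
Lemma known_kle k1 w : rank (wlayer e w) <= rank l' ->
  sgn b (sem M e (known k1) w) -> kle b k1 (kind e w).
Proof.
move=> wl; rewrite sgn_bigdj => -[l1]; rewrite mem_filter => /andP[l1l _].
rewrite sgn_bigcj => H; apply: contrapT => /negP nk.
have := H (wlayer e w, kind e w); rewrite mem_filter mem_enum wl nk => /(_ isT).
have [|_ _ h] := @separatorP b (l1, k1) (wlayer e w, kind e w); last exact: h.
by apply: IH => //; [exact: ltnW | lia].
Qed.

Lemma candidate_kind w : wlayer e w = l -> sgn b (sem M e (candidate (kind e w)) w).
Proof.
move=> wl; rewrite sgn_cj; split; first exact: atoms_at_least_kind.
rewrite sgn_bigcj => -[l2 k2]; rewrite mem_filter => /andP[/andP[/= rl nk] _].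
have [|_ h _] := @separatorP b (l, kind e w) (l2, k2); last by apply: h; rewrite ?wl.
by apply: IH => //; [exact: ltnW | lia].
Qed.

(** The rank is strictly smaller here: at the rank of [l'] the induction provides no separator from
    layer [l]. *)
Lemma candidate_kle k1 w : rank (wlayer e w) < rank l' ->
  sgn b (sem M e (candidate k1) w) -> kle b k1 (kind e w).
Proof.
move=> wl; rewrite sgn_cj => -[_]; rewrite sgn_bigcj => H; apply: contrapT => /negP nk.
have := H (wlayer e w, kind e w); rewrite mem_filter mem_enum wl nk => /(_ isT).
have [|_ _ h] := @separatorP b (l, k1) (wlayer e w, kind e w); last exact: h.
by apply: IH => //; [exact: ltnW | lia].
Qed.

Lemma candidate_atoms k1 w :
  sgn b (sem M e (candidate k1) w) -> sgn b (sem M e (atoms_at_least b k1) w).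
Proof. by rewrite sgn_cj => -[]. Qed.

Lemma rank_succ w v : acc M w v -> rank (wlayer e v) <= rank (wlayer e w).
Proof.
by move=> /(layer_succ (kind e) wM)[h|/ltnW h]; rewrite /wlayer ?h.
Qed.

End Model.

(** * Formulas for non-degenerate layers *)

Section Regular.
Variable Rs : {set kinds}.
Hypothesis lE : l = (Rs, None).

Definition target X k1 := dj b (known k1) (cj b (candidate k1) X).

(** The cover modality over [Rs]. It does not depend on the kind of the point, so one variable
    serves the whole layer. *)
Definition regular_body X :=
  cj b (bigcj b (enum Rs) (fun k1 => dia b (target X k1)))
    (box b (bigdj b (enum Rs) (target X))).

Definition regular_fix := fixp b fresh (regular_body (FVar fresh)).

Definition regular_formula k := cj b (candidate k) regular_fix.

Lemma clean_regular_formula k : clean fresh (regular_formula k).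
Proof.
apply: clean_cj; first exact: clean_candidate.
apply: clean_fixp; have bt k1 : binders fresh (target (FVar fresh) k1).
  apply/binders_cj; split; first exact: (clean_known k1).1.
  by apply/binders_cj; split=> //; apply: (clean_candidate k1).1.
apply/binders_cj; split.
  by apply: binders_bigcj => k1 _; apply/binders_dia.
by apply/binders_dia; apply: binders_bigcj.
Qed.

Lemma sgn_target M e e1 X k1 w : (forall f, clean fresh f -> sem M e1 f = sem M e f) ->
  sgn b (sem M e1 (target X k1) w) =
  (sgn b (sem M e (known k1) w) \/
   sgn b (sem M e (candidate k1) w) /\ sgn b (sem M e1 X w)).
Proof.
by move=> E; rewrite sgn_dj sgn_cj (E _ (clean_known k1)) (E _ (clean_candidate k1)).
Qed.

Lemma sgn_regular_body M e e1 X w : (forall f, clean fresh f -> sem M e1 f = sem M e f) ->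
  sgn b (sem M e1 (regular_body X) w) ->
  (forall k1, k1 \in Rs -> exists2 v, acc M w v & sgn b (sem M e (known k1) v) \/
     sgn b (sem M e (candidate k1) v) /\ sgn b (sem M e1 X v)) /\
  (forall v, acc M w v -> exists2 k1, k1 \in Rs & sgn b (sem M e (known k1) v) \/
     sgn b (sem M e (candidate k1) v) /\ sgn b (sem M e1 X v)).
Proof.
move=> E; rewrite sgn_cj sgn_bigcj sgn_box => -[h1 h2]; split.
  move=> k1 k1R; have := h1 k1; rewrite mem_enum sgn_dia => /(_ k1R)[v wv].
  by rewrite (sgn_target _ _ _ E); exists v.
move=> v /h2; rewrite sgn_bigdj => -[k1]; rewrite mem_enum (sgn_target _ _ _ E) => ? ?.
by exists k1.
Qed.

Lemma regular_formula_kind M e w : wK4 M -> wlayer e w = l ->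
  sgn b (sem M e (regular_formula (kind e w)) w).
Proof.
move=> wM wl; rewrite sgn_cj; split; first exact: candidate_kind.
(* The layer itself is the postfixed set. *)
apply: (fixp_coind (S := fun v => wlayer e v = l)) (wl) => {wl}w wl.
have E S f : clean fresh f -> sem M (upd e fresh S) f = sem M e f by exact: clean_upd.
have wlE : layer (acc M) (kind e) w = (Rs, None) by rewrite -lE.
have [see in_Rs] := layer_regular wlE.
have aim v S : acc M w v -> (wlayer e v = l -> sgn b (S v)) ->
    sgn b (sem M (upd e fresh S) (target (FVar fresh) (kind e v)) v).
  move=> wv hS; rewrite (sgn_target _ _ _ (E _)) /= updE eqxx.
  case: (layer_succ (kind e) wM wv) => h.
    have vl : wlayer e v = l by rewrite /wlayer h.
    by right; split; [apply: candidate_kind | apply: hS].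
  by left; apply: known_kind => //; rewrite -wl.
have hS v : wlayer e v = l -> sgn b (sgn b (wlayer e v = l)) by case: (b) => //= ? ?; auto.
rewrite sgn_cj sgn_bigcj sgn_box; split.
  move=> k1; rewrite mem_enum => /see[v wv <-]; rewrite sgn_dia; exists v => //.
  exact: (aim v (fun u => sgn b (wlayer e u = l)) wv (hS v)).
move=> v wv; rewrite sgn_bigdj; exists (kind e v); first by rewrite mem_enum in_Rs.
exact: (aim v (fun u => sgn b (wlayer e u = l)) wv (hS v)).
Qed.

Lemma regular_formulaP M e k w : sgn b (sem M e (regular_formula k) w) ->
  exists Y : world M -> Prop, [/\ Y w, sgn b (sem M e (candidate k) w),
    forall v, Y v -> forall k1, k1 \in Rs ->
      exists2 u, acc M v u & sgn b (sem M e (known k1) u) \/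
        sgn b (sem M e (candidate k1) u) /\ Y u &
    forall v, Y v -> forall u, acc M v u -> exists2 k1, k1 \in Rs &
      sgn b (sem M e (known k1) u) \/ sgn b (sem M e (candidate k1) u) /\ Y u].
Proof.
rewrite sgn_cj => -[cw fw]; exists (fun v => sgn b (sem M e regular_fix v)).
have unfold v : sgn b (sem M e regular_fix v) ->
    sgn b (sem M (upd e fresh (sem M e regular_fix)) (regular_body (FVar fresh)) v).
  by rewrite {1}/regular_fix /fixp -(propext (sem_fix _ _ _ _ _)).
have E f : clean fresh f -> sem M (upd e fresh (sem M e regular_fix)) f = sem M e f.
  exact: clean_upd.
by split=> // v /unfold/(sgn_regular_body E)[h1 h2] => [k1 /h1|u /h2];
  rewrite /= updE eqxx.
Qed.

End Regular.

(** * Formulas for degenerate layers *)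

Section Degenerate.
Variables (Rs A S E : {set kinds}).
Hypothesis lE : l = (Rs, Some (A, S, E)).

(** All worlds of a cluster see the same kinds outside it, so [E] is demanded of each. *)
Definition anchored k := cj b (candidate k) (bigcj b (enum E) (fun k1 => dia b (known k1))).
Definition outside := bigdj b (enum E) known.

(** The syntactic image of [roles], with [anchored], [outside] and [X] for [P], [Out] and [Y]. *)
Fixpoint role X j k :=
  match j with
  | 0 => cj b (anchored k) X
  | j.+1 => cj b (cj b (anchored k) X)
      (cj b (bigcj b (enum (seen_in A S k)) (fun k1 => dia b (role X j k1)))
        (box b (dj b outside (bigdj b (enum (seen_in A S k)) (role X j)))))
  end.

(* One more than the number of labels in [roles_stable]. *)
Definition rounds := (2 * #|kinds|).+1.

Definition degenerate_fix :=
  fixp b fresh (bigdj b (enum A) (role (FVar fresh) rounds.+1)).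

Definition degenerate_formula k := role degenerate_fix rounds.+1 k.

Lemma clean_anchored k : clean fresh (anchored k).
Proof.
apply: clean_cj; first exact: clean_candidate.
by apply: clean_bigcj => k1 _; apply: clean_dia; apply: clean_known.
Qed.

Lemma clean_outside : clean fresh outside.
Proof. by apply: clean_bigdj => k1 _; apply: clean_known. Qed.

Lemma binders_role X j : binders fresh X -> forall k, binders fresh (role X j k).
Proof.
move=> bX; elim: j => [|j IHj] k /=.
  by apply/binders_cj; split=> //; apply: (clean_anchored k).1.
apply/binders_cj; split.
  by apply/binders_cj; split=> //; apply: (clean_anchored k).1.
apply/binders_cj; split.
  by apply: binders_bigcj => k1 _; apply/binders_dia.
apply/binders_dia/binders_cj; split; first exact: clean_outside.1.
exact: binders_bigcj.
Qed.

Lemma clean_role X j : clean fresh X -> forall k, clean fresh (role X j k).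
Proof.
move=> bX; elim: j => [|j IHj] k /=.
  by apply: clean_cj => //; apply: clean_anchored.
apply: clean_cj; first by apply: clean_cj => //; apply: clean_anchored.
apply: clean_cj; first by apply: clean_bigcj => k1 _; apply: clean_dia.
apply: clean_dia; apply: clean_cj; first exact: clean_outside.
exact: clean_bigcj.
Qed.

Lemma clean_degenerate_formula k : clean fresh (degenerate_formula k).
Proof.
apply: clean_role; apply: clean_fixp.
by apply: binders_bigcj => k1 _; apply: binders_role.
Qed.

Lemma sgn_role M e e1 X j : (forall f, clean fresh f -> sem M e1 f = sem M e f) ->
  forall k w, sgn b (sem M e1 (role X j k) w) =
  roles (acc M) A S (fun k u => sgn b (sem M e (anchored k) u))
    (fun u => sgn b (sem M e outside u)) (fun u => sgn b (sem M e1 X u)) j k w.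
Proof.
move=> H; elim: j => [|j IHj] k w.
  by rewrite [role _ _ _]/= sgn_cj /= (H _ (clean_anchored k)).
rewrite [role _ _ _]/= sgn_cj [X in X /\ _]sgn_cj [X in _ /\ X]sgn_cj.
rewrite [X in _ /\ (X /\ _)]sgn_bigcj sgn_box (H _ (clean_anchored k)).
congr (_ /\ (_ /\ _)); apply: propext; split.
- by move=> h k1 k1O; have := h k1; rewrite mem_enum sgn_dia => /(_ k1O)[v ?];
    rewrite IHj; exists v.
- move=> h k1; rewrite mem_enum sgn_dia => /h[v ? ?]; exists v; rewrite ?IHj //.
- move=> h v /h; rewrite sgn_dj (H _ clean_outside).
  rewrite [X in _ \/ X]sgn_bigdj => -[?|[k1]]; first by left.
  by rewrite mem_enum IHj; right; exists k1.
- move=> h v /h hv; rewrite sgn_dj (H _ clean_outside).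
  case: hv => [?|[k1 ? ?]]; first by left.
  by right; rewrite sgn_bigdj; exists k1; rewrite ?mem_enum ?IHj.
Qed.

Lemma role_kind M e (Y : world M -> Prop) j : wK4 M ->
  (forall v, wlayer e v = l -> Y v) -> forall w, wlayer e w = l ->
  roles (acc M) A S (fun k u => sgn b (sem M e (anchored k) u))
    (fun u => sgn b (sem M e outside u)) Y j (kind e w) w.
Proof.
move=> wM hY.
have base w : wlayer e w = l -> sgn b (sem M e (anchored (kind e w)) w) /\ Y w.
  move=> wl; split; last exact: hY.
  have wlE : layer (acc M) (kind e) w = (Rs, Some (A, S, E)) by rewrite -lE.
  have [_ _ seeE _] := layer_degenerate wM wlE.
  rewrite sgn_cj sgn_bigcj; split; first exact: candidate_kind.
  move=> k1; rewrite mem_enum => /seeE[v wv [vw <-]]; rewrite sgn_dia; exists v => //.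
  by apply: known_kind => //; rewrite -wl.
elim: j => [|j IHj] w wl; first exact: base.
split; first exact: base.
have wlE : layer (acc M) (kind e) w = (Rs, Some (A, S, E)) by rewrite -lE.
have [_ seeO _ succ] := layer_degenerate wM wlE.
split.
  move=> k1 /seeO[v wv [vw <-]]; exists v => //; apply: IHj.
  by rewrite /wlayer vw.
move=> v /succ[[vw kO]|[vw kE]]; [right | left].
  by exists (kind e v) => //; apply: IHj; rewrite /wlayer vw.
rewrite sgn_bigdj; exists (kind e v); rewrite ?mem_enum //.
by apply: known_kind => //; rewrite -wl.
Qed.

Lemma degenerate_formula_kind M e w : wK4 M -> wlayer e w = l ->
  sgn b (sem M e (degenerate_formula (kind e w)) w).
Proof.
move=> wM wl; rewrite (sgn_role _ _ (e := e)) //; apply: role_kind => // {wl}w wl.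
apply: (fixp_coind (S := fun v => wlayer e v = l)) (wl) => {wl}w wl.
rewrite sgn_bigdj; exists (kind e w).
  have wlE : layer (acc M) (kind e) w = (Rs, Some (A, S, E)) by rewrite -lE.
  by have [kA _ _ _] := layer_degenerate wM wlE; rewrite mem_enum.
rewrite (sgn_role _ _ (e := e)) => [|f cf]; last exact: clean_upd.
apply: role_kind => // v vl; rewrite /= updE eqxx; by case: (b) => //= ? ?; auto.
Qed.

(** [G] is [roles] at [rounds.+1]. A step leads to level [rounds], and [roles_stable] restores the
    lost round, so [G] persists along in-cluster steps. *)
Lemma degenerate_formulaP M e : wK4 M -> exists G : kinds -> world M -> Prop,
  [/\ forall k w, k \in A -> sgn b (sem M e (degenerate_formula k) w) -> G k w,
    forall k w, G k w -> k \in A -> sgn b (sem M e (candidate k) w),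
    forall k w, G k w -> forall k1, k1 \in E ->
      exists2 v, acc M w v & sgn b (sem M e (known k1) v),
    forall k w, G k w -> k \in A -> forall k1, k1 \in seen_in A S k ->
      exists2 v, acc M w v & G k1 v
  & forall k w, G k w -> k \in A -> forall v, acc M w v ->
      (exists2 k1, k1 \in E & sgn b (sem M e (known k1) v)) \/
      (exists2 k1, k1 \in seen_in A S k & G k1 v)].
Proof.
move=> wM; set P := fun k u => sgn b (sem M e (anchored k) u).
set Out := fun u => sgn b (sem M e outside u).
pose Y u := sgn b (sem M e degenerate_fix u).
exists (roles (acc M) A S P Out Y rounds.+1).
have stable := roles_stable (R := acc M) wM (A := A) (S := S) (P := P) (Out := Out) (Y := Y)
  (n := rounds) erefl.
have {}stable : forall k w, k \in A -> roles (acc M) A S P Out Y rounds k w ->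
    roles (acc M) A S P Out Y rounds.+1 k w.
  apply: stable => w; rewrite /Y {1}/degenerate_fix /fixp -(propext (sem_fix _ _ _ _ _)).
  rewrite sgn_bigdj => -[k]; rewrite mem_enum => kA.
  rewrite (sgn_role _ _ (e := e)) => [|f cf]; last exact: clean_upd.
  by rewrite /= updE eqxx; exists k.
split.
- by move=> k w kA; rewrite (sgn_role _ _ (e := e)).
- by move=> k w [[+ _] _] _; rewrite /P sgn_cj => -[].
- move=> k w [[+ _] _] k1 k1E; rewrite /P sgn_cj sgn_bigcj => -[_ /(_ k1)].
  by rewrite mem_enum sgn_dia; apply.
- move=> k w [_ [D _]] kA k1 k1O; have [v wv rv] := D _ k1O; exists v => //.
  by apply: stable => //; apply: (subsetP (seen_in_sub A S k)).
- move=> k w [_ [_ X]] kA v /X[|[k1 k1O r1]]; last right.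
    by rewrite /Out sgn_bigdj => -[k1]; rewrite mem_enum; left; exists k1.
  by exists k1 => //; apply: stable => //; apply: (subsetP (seen_in_sub A S k)).
Qed.

End Degenerate.

End Step.
End Separation.

(** * Induction on ranks and the collapsed formula *)

Section Collapse.
Variable phi : form.

Local Notation layer_id := (layer_id (kinds phi)).
Local Notation kind := (@kind phi _).
Local Notation wlayer := (@wlayer phi _).
Local Notation separable := (@separable phi).

Definition lower_separable b (l l' : layer_id) := forall l1 k1 l2 k2,
  rank l1 <= rank l -> rank l2 <= rank l' ->
  rank l1 + rank l2 < rank l + rank l' -> ~~ kle b k1 k2 ->
  separable b (l1, k1) (l2, k2).

Lemma lower_separable_negb b l l' : lower_separable b l l' -> lower_separable (~~ b) l' l.
Proof.
move=> IH l1 k1 l2 k2 r1 r2 r nk; apply: separable_negb; apply: IH => //.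
  by rewrite addnC [rank l + _]addnC.
by rewrite kle_negb in nk.
Qed.

(** A claim true throughout type [t] must hold at some point of type [t'], since it would otherwise
    separate. *)
Lemma not_separable_witness b t t' f : ~ separable b t t' -> clean (fresh phi) f ->
  (forall M e w, wK4 M -> (wlayer e w, kind e w) = t -> sgn b (sem M e f w)) ->
  exists M e w, [/\ wK4 M, (wlayer e w, kind e w) = t' & sgn b (sem M e f w)].
Proof.
move=> ns cf h; apply: contrapT => no; apply: ns; exists f; split=> // M e w wM E hf.
by apply: no; exists M, e, w.
Qed.

(** The opposite player cannot separate the swapped pair; the trivial claim then yields the
    point. *)
Lemma not_separable_inhabited b t t' : ~ separable b t t' ->
  exists M (e : nat -> world M -> Prop) w, wK4 M /\ (wlayer e w, kind e w) = t.
Proof.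
move=> ns; have ns' : ~ separable (~~ b) t' t.
  by move/separable_negb; rewrite negbK.
have [||M [e [w [wM E _]]]] := not_separable_witness (f := top (~~ b)) ns'.
- by rewrite /clean; case: (b) => /=; tauto.
- by move=> M e w _ _; case: (b) => //= -[].
- by exists M, e, w.
Qed.

(** Either [v] stays in layer [l'], where a candidate claim persists, or its rank drops and the
    induction hypothesis settles its kind. *)
Lemma claim_cases b l l' M e (Y : world M -> Prop) k1 w v : lower_separable b l l' ->
  wK4 M -> wlayer e w = l' -> acc M w v ->
  sgn b (sem M e (known b l l' k1) v) \/ sgn b (sem M e (candidate b l l' k1) v) /\ Y v ->
  kle b k1 (kind e v) \/
  [/\ wlayer e v = l', Y v & sgn b (sem M e (candidate b l l' k1) v)].
Proof.
move=> IH wM wl wv; have vl : rank (wlayer e v) <= rank l'.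
  by rewrite -wl; apply: rank_succ.
case=> [kn|[cd Yv]]; first by left; apply: known_kle kn.
have [E|lt] := layer_succ (kind e) wM wv.
  by right; split=> //; rewrite /wlayer E.
by left; apply: candidate_kle cd => //; rewrite -wl.
Qed.

(** A point of layer [l'] fooled by the formula of [l] simulates any point of type [(l, k)]: [rho]
    lets [u] play the kind of [u0]. *)
Lemma degenerate_separable b l l' Rs A S E k k' : lower_separable b l l' ->
  l = (Rs, Some (A, S, E)) -> ~~ kle b k k' -> separable b (l, k) (l', k').
Proof.
move=> IH lE /negP nk; apply: contrapT => ns; apply: nk.
have [M0 [e0 [w0 [wM0 [w0l w0k]]]]] := not_separable_inhabited ns.
have [||M [e [w [wM [wl wk] hw]]]] :=
    not_separable_witness (f := degenerate_formula b l l' A S E k) ns.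
- exact: clean_degenerate_formula.
- by move=> M e w wM [wl <-]; apply: (degenerate_formula_kind IH lE).
have [G [hG cand seeE seeO succ]] := @degenerate_formulaP phi b l l' A S E M e wM.
pose rho u0 u := [/\ wlayer e0 u0 = l, wlayer e u = l' & G (kind e0 u0) u].
have inA u0 : wlayer e0 u0 = l -> kind e0 u0 \in A.
  move=> u0l; have uE : layer (acc M0) (kind e0) u0 = (Rs, Some (A, S, E)) by rewrite -lE.
  by have [] := layer_degenerate wM0 uE.
rewrite -w0k -wk; apply: (@simulation_kle phi b M0 e0 M e rho).
- move=> u0 u [u0l ul Gu]; apply: candidate_atoms (cand _ _ Gu _); exact: inA.
- move=> u0 u [u0l ul Gu] v0 uv0.
  have uE : layer (acc M0) (kind e0) u0 = (Rs, Some (A, S, E)) by rewrite -lE.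
  have [kA _ _ succ0] := layer_degenerate wM0 uE.
  case: (succ0 _ uv0) => [[v0l kO]|[_ kE]].
    have v0l' : wlayer e0 v0 = l by rewrite /wlayer v0l.
    have [v uv Gv] := seeO _ _ Gu kA _ kO; exists v => //.
    have [|k1|//] := claim_cases (Y := G (kind e0 v0)) (k1 := kind e0 v0) IH wM ul uv.
    + by right; split=> //; apply: cand => //; apply: inA.
    + by right.
    + by case=> vl _ _; left.
  have [v uv kn] := seeE _ _ Gu _ kE; exists v => //; right.
  by apply: known_kle kn => //; rewrite -ul; apply: rank_succ.
- move=> u0 u [u0l ul Gu] v uv.
  have uE : layer (acc M0) (kind e0) u0 = (Rs, Some (A, S, E)) by rewrite -lE.
  have [kA seeO0 seeE0 _] := layer_degenerate wM0 uE.
  case: (succ _ _ Gu kA _ uv) => [[k1 k1E kn]|[k1 k1O Gv]].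
    have [v0 uv0 [_ kv0]] := seeE0 _ k1E; exists v0 => //; right; rewrite kv0.
    by apply: known_kle kn => //; rewrite -ul; apply: rank_succ.
  have [v0 uv0 [v0l kv0]] := seeO0 _ k1O; exists v0 => //.
  have v0l' : wlayer e0 v0 = l by rewrite /wlayer v0l.
  have [|?|[vl _ _]] := claim_cases (Y := G k1) (k1 := k1) IH wM ul uv.
  + right; split=> //; apply: cand => //; exact: (subsetP (seen_in_sub A S _) _ k1O).
  + by right; rewrite kv0.
  + by left; rewrite /rho kv0.
- by split=> //; rewrite w0k; apply: hG => //; rewrite -w0k; apply: inA.
Qed.

(** Two counterexamples are taken: [M] fools the claim to be in [l], [M0] fools the opposite
    player's claim about [l']. [rho] links points where both fixed points hold. *)
Lemma regular_separable b l l' Rs Rs' k k' : lower_separable b l l' ->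
  l = (Rs, None) -> l' = (Rs', None) -> ~~ kle b k k' -> separable b (l, k) (l', k').
Proof.
move=> IH lE lE' /negP nk; apply: contrapT => ns; apply: nk.
have IH' := lower_separable_negb IH.
have ns' : ~ separable (~~ b) (l', k') (l, k).
  by move/separable_negb; rewrite negbK.
have [||M [e [w [wM [wl wk] hw]]]] :=
    not_separable_witness (f := regular_formula b l l' Rs k) ns.
- exact: clean_regular_formula.
- by move=> M e w wM [wl <-]; apply: (regular_formula_kind IH lE).
have [||M0 [e0 [w0 [wM0 [w0l w0k] hw0]]]] :=
    not_separable_witness (f := regular_formula (~~ b) l' l Rs' k') ns'.
- exact: clean_regular_formula.
- by move=> M0 e0 w0 wM0 [wl0 <-]; apply: (regular_formula_kind IH' lE').
have [Y [Yw cw Ysee Ysucc]] := regular_formulaP hw.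
have [Y0 [Yw0 cw0 Ysee0 Ysucc0]] := regular_formulaP hw0.
pose rho u0 u := [/\ wlayer e0 u0 = l, wlayer e u = l', Y0 u0, Y u &
  sgn b (sem M e (atoms_at_least b (kind e0 u0)) u)].
rewrite -w0k -wk; apply: (@simulation_kle phi b M0 e0 M e rho).
- by move=> u0 u [].
- move=> u0 u [u0l ul Y0u Yu _] v0 uv0.
  have uE : layer (acc M) (kind e) u = (Rs', None) by rewrite -lE'.
  have uE0 : layer (acc M0) (kind e0) u0 = (Rs, None) by rewrite -lE.
  have [see _] := layer_regular uE; have [_ in_Rs] := layer_regular uE0.
  (* The claim in [M0] is asked first. If it settles [v0], the kind [k2] is seen by [u], whose layer
     is regular; otherwise the claim in [M] supplies a successor for the kind of [v0]. *)
  have [k2 k2R /(claim_cases IH' wM0 u0l uv0)] := Ysucc0 _ Y0u _ uv0.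
  rewrite kle_negb => -[le|[v0l Y0v _]].
    by have [v uv kv] := see _ k2R; exists v => //; right; rewrite kv.
  have [v uv /(claim_cases IH wM ul uv) cl] := Ysee _ Yu _ (in_Rs _ uv0); exists v => //.
  case: cl => [|[vl Yv cv]]; [by right | left; split=> //].
  exact: candidate_atoms cv.
- move=> u0 u [u0l ul Y0u Yu _] v uv.
  have uE : layer (acc M) (kind e) u = (Rs', None) by rewrite -lE'.
  have uE0 : layer (acc M0) (kind e0) u0 = (Rs, None) by rewrite -lE.
  have [see _] := layer_regular uE0; have [_ in_Rs] := layer_regular uE.
  have [k2 k2R /(claim_cases IH wM ul uv)] := Ysucc _ Yu _ uv.
  case=> [le|[vl Yv _]].
    by have [v0 uv0 kv0] := see _ k2R; exists v0 => //; right; rewrite kv0.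
  have [v0 uv0 /(claim_cases IH' wM0 u0l uv0) cl] := Ysee0 _ Y0u _ (in_Rs _ uv).
  exists v0 => //; rewrite kle_negb in cl.
  case: cl => [|[v0l Y0v cv]]; [by right | left; split=> //].
  exact: atoms_at_least_negb (candidate_atoms cv).
- split=> //; rewrite w0k; exact: candidate_atoms cw.
Qed.

(** Strong induction on the sum of ranks. If only [l'] is degenerate, the swapped pair is separated
    for the refuter. *)
Lemma kinds_separable l l' k k' : ~~ kle true k k' -> separable true (l, k) (l', k').
Proof.
have [n] := ubnP (rank l + rank l'); elim: n l l' k k' => // n IHn l l' k k' ln nk.
have IH : lower_separable true l l'.
  by move=> l1 k1 l2 k2 _ _ lt; apply: IHn; apply: leq_trans lt _.
case lE : l => [Rs [[[A S] E]|]]; first by rewrite -lE; exact: (degenerate_separable IH lE nk).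
case lE' : l' => [Rs' [[[A S] E]|]].
  rewrite -lE -lE'; apply: (@separable_negb _ false).
  by apply: (degenerate_separable (lower_separable_negb IH) lE'); rewrite kle_negb.
by rewrite -lE -lE'; exact: (regular_separable IH lE lE' nk).
Qed.

Definition collapse :=
  bigdj true [seq t : wtype phi <- enum (wtype phi)
    | `[< exists M (e : nat -> world M -> Prop) w, [/\ wK4 M,
          (wlayer e w, kind e w) = t & sem M e phi w] >]]
    (fun t => bigcj true [seq t' : wtype phi <- enum (wtype phi) | ~~ kle true t.2 t'.2]
      (separator true t)).

Lemma clean_collapse : clean (fresh phi) collapse.
Proof. by apply: clean_bigdj => t _; apply: clean_bigcj => t' _; apply: clean_separator. Qed.

Lemma collapse_equiv : equiv_wK4 phi collapse.
Proof.
move=> M e wM w.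
have -> : sem M e collapse w = sgn true (sem M e collapse w) by [].
rewrite sgn_bigdj; split=> [hw|[t]].
  exists (wlayer e w, kind e w).
    by rewrite mem_filter mem_enum andbT; apply/asboolP; exists M, e, w.
  rewrite sgn_bigcj => -[l' k']; rewrite mem_filter => /andP[nk _].
  by have [_ h _] := separatorP (kinds_separable (wlayer e w) l' nk); apply: h.
rewrite mem_filter => /andP[/asboolP[M0 [e0 [w0 [wM0 <- hw0]]]] _].
rewrite sgn_bigcj => H; apply: contrapT => nw.
(* [phi] heads its own closure, so its truth passes to every larger kind. *)
have nk : ~~ kle true (kind e0 w0) (kind e w).
  by apply/negP => /kind_sub[_ /clos_le_sem]; auto.
have [_ _ h] := separatorP (kinds_separable (wlayer e0 w0) (wlayer e w) nk).
by apply: (h M e w wM erefl); apply: H; rewrite mem_filter mem_enum /= nk.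
Qed.


End Collapse.

Theorem mainTheorem4 :
  forall phi : form, exists psi : form, no_nested_fp psi /\ equiv_wK4 phi psi.
Proof.
move=> phi; exists (collapse phi); split; last exact: collapse_equiv.
exact: binders_no_nested (clean_collapse phi).1.
Qed.
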